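(* Let $(M,g)$ be a Riemannian manifold, let $\pi:E\to M$ be a vector bundle of rank $k\ge1$ with fiber metric $h$ and compatible connection $D$, and let $G$ be the spherically symmetric metric on the total space $E$ with weight functions $\varphi_1=\varphi_2=0$. Let $F:E\to\mathbb{R}$, $F(e)=\alpha(r)$ with $r=h(e,e)$, be an $r$-radial function constructed from a function $\alpha:[0,+\infty)\to\mathbb{R}$. If $\alpha$ is a polynomial function of degree $1$, then $F$ is biharmonic on $(E,G)$.
   Context: All manifolds and geometric objects are smooth ($C^\infty$); manifolds are connected and without boundary. $(E,\pi,M)$ is a real vector bundle of rank $k$ over the Riemannian manifold $(M,g)$, with a (Riemannian) fiber metric $h$ and a connection $D$ with $Dh=0$. Let $K$ be the connection map of $D$. A spherically symmetric metric on $E$ is $G_e(X,Y)=e^{2\varphi_1}g(d\pi(X),d\pi(Y))+e^{2\varphi_2}h(K_e(X),K_e(Y))$ for $X,Y\in T_eE$, with $\varphi_1,\varphi_2$ functions of $r=h(e,e)$; for $\varphi_1=\varphi_2=0$ it is the Sasaki metric $G_e(X,Y)=g(d\pi(X),d\pi(Y))+h(K_e(X),K_e(Y))$. A smooth function $F$ on $(E,G)$ is biharmonic if $\Delta_G^2F=\Delta_G(\Delta_GF)=0$, with $\Delta_G$ the Laplace–Beltrami operator. *)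

(* Defs.v *)
From HB Require Import structures.
From mathcomp Require Import all_boot all_order all_algebra.
From mathcomp Require Import all_classical all_reals all_analysis.

Set Implicit Arguments.
Unset Strict Implicit.
Unset Printing Implicit Defensive.

Import Order.TTheory GRing.Theory Num.Theory.
Import numFieldNormedType.Exports.

Local Open Scope classical_set_scope.
Local Open Scope ring_scope.

Definition pderiv (R : realType) (n : nat) (i : 'I_n) (f : 'rV[R]_n -> R) :
  'rV[R]_n -> R := fun x => 'D_(delta_mx 0 i) f x.

(* C^oo on a neighbourhood of x: all iterated partial derivatives
   d_i1 (d_i2 (... f)) exist and are differentiable there. *)
Definition smooth_near (R : realType) (n : nat) (f : 'rV[R]_n -> R)
    (x : 'rV[R]_n) : Prop :=
  \forall y \near x, forall s : seq 'I_n,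
    differentiable (foldr (@pderiv R n) f s) y.

(* Only the values of [cmap] on [cdom], and of [cinv] on [cmap @` cdom],
   are meaningful. *)
Record chart (R : realType) (n : nat) (X : Type) := Chart {
  cdom : set X;
  cmap : X -> 'rV[R]_n;
  cinv : 'rV[R]_n -> X }.

Definition ccod (R : realType) (n : nat) (X : Type) (c : chart R n X) :
  set 'rV[R]_n := cmap c @` cdom c.

Definition smooth_at (R : realType) (n : nat) (X : Type)
    (A : set (chart R n X)) (p : X) (f : X -> R) : Prop :=
  forall c, A c -> cdom c p -> smooth_near (f \o cinv c) (cmap c p).

Record smooth_manifold (R : realType) (n : nat) (M : topologicalType)
    (A : set (chart R n M)) : Prop := SmoothManifold {
  manifold_hausdorff : hausdorff_space M;
  manifold_second_countable : @second_countable M;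
  manifold_connected : connected [set: M];
  atlas_cover : forall p, exists2 c, A c & cdom c p;
  atlas_open_dom : forall c, A c -> open (cdom c);
  atlas_open_cod : forall c, A c -> open (ccod c);
  atlas_mapK : forall c p, A c -> cdom c p -> cinv c (cmap c p) = p;
  atlas_map_cont : forall c, A c -> {within cdom c, continuous (cmap c)};
  atlas_inv_cont : forall c, A c -> {within ccod c, continuous (cinv c)};
  (* the coordinates of each chart are smooth in every other chart *)
  atlas_compat : forall c i p, A c -> cdom c p ->
    smooth_at A p (fun q => cmap c q 0 i) }.

(* Tangent vectors at p are derivations at p of the functions that are smooth
   near p.  They are represented as functionals on all functions, with value 0
   on those that are not smooth near p, so that equal tangent vectors are equal
   functionals.  As the functions are arbitrary away from p, the Leibniz rule
   applied to indicator functions of neighbourhoods of p shows that v f only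
   depends on the germ of f at p. *)
Definition functional (R : realType) (X : Type) : lmodType R :=
  (X -> R) -> R^o.

Record tangent (R : realType) (n : nat) (X : Type) (A : set (chart R n X))
    (p : X) (v : functional R X) : Prop := Tangent {
  tangent_nonsmooth : forall f, ~ smooth_at A p f -> v f = 0;
  tangent_linear : forall (a : R) f g, smooth_at A p f -> smooth_at A p g ->
    v (fun q => a * f q + g q) = a * v f + v g;
  tangent_leibniz : forall f g, smooth_at A p f -> smooth_at A p g ->
    v (fun q => f q * g q) = f p * v g + g p * v f }.

Definition restrict_smooth (R : realType) (n : nat) (X : Type)
    (A : set (chart R n X)) (p : X) (v : (X -> R) -> R) : functional R X :=
  fun f => if `[< smooth_at A p f >] then v f else 0.

(* The coordinate vector d/dx_i of the chart c at p. *)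
Definition coord_vec (R : realType) (n : nat) (X : Type)
    (A : set (chart R n X)) (c : chart R n X) (i : 'I_n) (p : X) :
    functional R X :=
  restrict_smooth A p (fun f => pderiv i (f \o cinv c) (cmap c p)).

(* The differential at p of phi : X -> Y, where A is the atlas of Y. *)
Definition tangent_map (R : realType) (m : nat) (X Y : Type)
    (A : set (chart R m Y)) (phi : X -> Y) (p : X) (v : functional R X) :
    functional R Y :=
  restrict_smooth A (phi p) (fun f => v (f \o phi)).

Record inner_product_on (R : realType) (V : lmodType R) (S : set V)
    (b : V -> V -> R) : Prop := InnerProductOn {
  inner_linear : forall (a : R) u v w, S u -> S v -> S w ->
    b (a *: u + v) w = a * b u w + b v w;
  inner_sym : forall u v, S u -> S v -> b u v = b v u;
  inner_pos : forall u, S u -> u != 0 -> 0 < b u u }.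

Record riemannian_metric (R : realType) (n : nat) (X : Type)
    (A : set (chart R n X))
    (g : X -> functional R X -> functional R X -> R) : Prop :=
    RiemannianMetric {
  riemannian_inner : forall p, inner_product_on (tangent A p) (g p);
  riemannian_smooth : forall c i j p, A c -> cdom c p ->
    smooth_at A p (fun q => g q (coord_vec A c i q) (coord_vec A c j q)) }.

Section LaplaceBeltrami.
Variables (R : realType) (n : nat) (X : Type) (A : set (chart R n X)).
Variable G : X -> functional R X -> functional R X -> R.

Definition gram (c : chart R n X) (p : X) : 'M[R]_n :=
  \matrix_(i, j) G p (coord_vec A c i p) (coord_vec A c j p).

(* |G|^(-1/2) \sum_i d_i (|G|^(1/2) \sum_j G^ij d_j F)  in the chart c *)
Definition laplacian_in (c : chart R n X) (F : X -> R) (p : X) : R :=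
  let vol x := Num.sqrt (\det (gram c (cinv c x))) in
  let flux i x := vol x *
    \sum_j invmx (gram c (cinv c x)) i j * pderiv j (F \o cinv c) x in
  (vol (cmap c p))^-1 * \sum_i pderiv i (flux i) (cmap c p).

(* L is the image of F under the Laplace-Beltrami operator. *)
Definition is_laplacian (F L : X -> R) : Prop :=
  forall c p, A c -> cdom c p -> L p = laplacian_in c F p.

Definition smooth_fun (F : X -> R) : Prop := forall p, smooth_at A p F.

Definition biharmonic (F : X -> R) : Prop :=
  smooth_fun F /\
  exists L, [/\ smooth_fun L, is_laplacian F L & is_laplacian L (fun=> 0)].

End LaplaceBeltrami.

(* A vector bundle over M is given by its fibers E p and a set of local
   trivializations; the total space is {p : M & E p}. *)
Record trivialization (R : realType) (k : nat) (M : Type)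
    (E : M -> lmodType R) := Trivialization {
  tdom : set M;
  tmap : forall p, E p -> 'rV[R]_k;
  tinv : forall p, 'rV[R]_k -> E p }.

Definition frame (R : realType) (k : nat) (M : Type) (E : M -> lmodType R)
    (t : trivialization k E) (a : 'I_k) (p : M) : E p :=
  tinv t p (delta_mx 0 a).

Record vector_bundle (R : realType) (n k : nat) (M : topologicalType)
    (A : set (chart R n M)) (E : M -> lmodType R)
    (T : set (trivialization k E)) : Prop := VectorBundle {
  bundle_cover : forall p, exists2 t, T t & tdom t p;
  bundle_open : forall t, T t -> open (tdom t);
  bundle_linear : forall t p, T t -> tdom t p ->
    forall (a : R) u w, @tmap _ _ _ _ t p (a *: u + w) =
                        a *: tmap t u + tmap t w;
  bundle_mapK : forall t p, T t -> tdom t p ->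
    cancel (@tmap _ _ _ _ t p) (@tinv _ _ _ _ t p);
  bundle_invK : forall t p, T t -> tdom t p ->
    cancel (@tinv _ _ _ _ t p) (@tmap _ _ _ _ t p);
  bundle_compat : forall t t' a b p, T t -> T t' -> tdom t p -> tdom t' p ->
    smooth_at A p (fun q => tmap t' (frame t a q) 0 b) }.

Definition total_space (R : realType) (M : Type) (E : M -> lmodType R) :
  Type := {p : M & E p}.

Definition bundle_proj (R : realType) (M : Type) (E : M -> lmodType R)
  (e : total_space E) : M := projT1 e.

Definition in_fiber (R : realType) (M : Type) (E : M -> lmodType R)
  (p : M) (u : E p) : total_space E := existT (fun q => E q : Type) p u.

(* (x, u) |-> (coordinates of the base in_fiber, coordinates in the fiber) *)
Definition total_chart (R : realType) (n k : nat) (M : Type)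
    (E : M -> lmodType R) (c : chart R n M) (t : trivialization k E) :
    chart R (n + k) (total_space E) :=
  Chart [set e | cdom c (bundle_proj e) /\ tdom t (bundle_proj e)]
        (fun e => row_mx (cmap c (bundle_proj e)) (tmap t (projT2 e)))
        (fun y => in_fiber (tinv t (cinv c (lsubmx y)) (rsubmx y))).

Definition total_atlas (R : realType) (n k : nat) (M : Type)
    (A : set (chart R n M)) (E : M -> lmodType R)
    (T : set (trivialization k E)) :
    set (chart R (n + k) (total_space E)) :=
  [set C | exists c t, [/\ A c, T t & C = total_chart c t]].

Section Bundle.
Variables (R : realType) (n k : nat) (M : Type) (A : set (chart R n M)).
Variables (E : M -> lmodType R) (T : set (trivialization k E)).

Local Notation AE := (total_atlas A T).

Definition smooth_section_at (p : M) (s : forall q, E q) : Prop :=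
  forall t b, T t -> tdom t p -> smooth_at A p (fun q => tmap t (s q) 0 b).

Record fiber_metric (h : forall p, E p -> E p -> R) : Prop := FiberMetric {
  fiber_inner : forall p, inner_product_on [set: E p] (h p);
  fiber_smooth : forall t a b p, T t -> tdom t p ->
    smooth_at A p (fun q => h q (frame t a q) (frame t b q)) }.

(* D p v s is the covariant derivative at p of s along v, for v tangent at p
   and s a section that is smooth near p.  As for tangent vectors, the Leibniz
   rule implies that it only depends on the germ of s at p. *)
Record connection
    (D : forall p, functional R M -> (forall q, E q) -> E p) : Prop :=
    Connection {
  connection_linear : forall p (a : R) v w s,
    tangent A p v -> tangent A p w -> smooth_section_at p s ->
    D p (a *: v + w) s = a *: D p v s + D p w s;
  connection_additive : forall p v s s', tangent A p v ->
    smooth_section_at p s -> smooth_section_at p s' ->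
    D p v (fun q => s q + s' q) = D p v s + D p v s';
  connection_leibniz : forall p v f s, tangent A p v ->
    smooth_at A p f -> smooth_section_at p s ->
    D p v (fun q => f q *: s q) = v f *: s p + f p *: D p v s;
  connection_smooth : forall c i p s, A c -> cdom c p ->
    smooth_section_at p s ->
    smooth_section_at p (fun q => D q (coord_vec A c i q) s) }.

(* D h = 0 *)
Definition compatible
    (D : forall p, functional R M -> (forall q, E q) -> E p)
    (h : forall p, E p -> E p -> R) : Prop :=
  forall p v s s', tangent A p v ->
    smooth_section_at p s -> smooth_section_at p s' ->
    v (fun q => h q (s q) (s' q)) =
    h p (D p v s) (s' p) + h p (s p) (D p v s').

(* The velocity at t = 0 of the curve t |-> u + t w in the fiber over p. *)
Definition vertical_lift (p : M) (u w : E p) :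
    functional R (total_space E) :=
  restrict_smooth AE (in_fiber u)
    (fun f => derive1 (fun t : R => f (in_fiber (u + t *: w))) 0).

(* K e : T_e E -> E_(bundle_proj e) is the linear map determined by
   K (ds (v)) = D_v s and K (vertical lift of w) = w. *)
Record connection_map
    (D : forall p, functional R M -> (forall q, E q) -> E p)
    (K : forall e : total_space E,
       functional R (total_space E) -> E (bundle_proj e)) : Prop :=
    ConnectionMap {
  connection_map_linear : forall e (a : R) X Y,
    tangent AE e X -> tangent AE e Y ->
    K e (a *: X + Y) = a *: K e X + K e Y;
  connection_map_section : forall p v s, tangent A p v ->
    smooth_section_at p s ->
    K (in_fiber (s p)) (tangent_map AE (fun q => in_fiber (s q)) p v) = D p v s;
  connection_map_vertical : forall p (u w : E p),
    K (in_fiber u) (vertical_lift u w) = w }.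

Variable g : M -> functional R M -> functional R M -> R.
Variable h : forall p, E p -> E p -> R.
Variable K :
  forall e : total_space E, functional R (total_space E) -> E (bundle_proj e).

Definition fiber_sqnorm (e : total_space E) : R := h (projT2 e) (projT2 e).

Definition spherically_symmetric_metric (phi1 phi2 : R -> R)
    (e : total_space E) (X Y : functional R (total_space E)) : R :=
  expR (2 * phi1 (fiber_sqnorm e)) *
    g (bundle_proj e) (tangent_map A (@bundle_proj R M E) e X)
                    (tangent_map A (@bundle_proj R M E) e Y) +
  expR (2 * phi2 (fiber_sqnorm e)) * h (K e X) (K e Y).

End Bundle.

(* Main.v *)
Require Import Defs.
From HB Require Import structures.
From mathcomp Require Import all_boot all_order all_algebra.
From mathcomp Require Import all_classical all_reals all_analysis.
From mathcomp Require Import ring.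

Set Implicit Arguments.
Unset Strict Implicit.
Unset Printing Implicit Defensive.

Import Order.TTheory GRing.Theory Num.Theory.
Import numFieldNormedType.Exports.

Local Open Scope classical_set_scope.
Local Open Scope ring_scope.

(** With both weights equal to 1, [alpha (h(e,e))] is [a r + b], where
    [r (e) = h(e,e)], and everything follows from one identity: the gradient of
    [r] at [e] is the vertical vector [2 e].  Indeed [K e] sends a vertical
    vector to itself, so that pairing [2 e] with a vertical vector [w] gives
    [2 h(w, e) = dr(w)].  Pairing it with the coordinate vector [d/dx_i] gives
    [2 h(K(d/dx_i), e)].  Now [d/dx_i] is the velocity of a section [s] through
    [e] with constant components in the local frame, so [K(d/dx_i)] is the
    covariant derivative of [s], and [D h = 0] turns the pairing into the
    derivative of [h(s,s)], that is [dr(d/dx_i)].  This is [gram_radial]; no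
    Christoffel symbol ever has to be differentiated.

    In the coordinates [(x,u)] of the bundle the volume density does not depend
    on [u]: the Gram matrix is congruent, by a unipotent matrix, to the block
    diagonal matrix of [g] and [h] ([gram_block], [det_gram_total]).  Hence the
    flux of [a r + b] is the density times [(0, 2 a u)] and its divergence,
    divided by the density, is the constant [2 k a] ([laplacian_radial]).  The
    Laplacian of a constant is 0.

    The remaining work is of two kinds.  Tangent vectors being derivations, the
    computation of [d pi] and [K] on coordinate vectors amounts to knowing that
    the functions met along the way are smooth, which requires the closure
    properties of smooth functions.  And dividing by the density requires the
    Gram determinant to be positive, which holds for a positive definite matrix
    by taking Schur complements ([det_posdef]). *)

(** * Partial derivatives and smooth functions of several variables *)

Lemma near_eq_differentiable (R : realType) (V W : normedModType R)
    (f g : V -> W) (x : V) :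
  (\forall y \near x, f y = g y) -> differentiable f x -> differentiable g x.
Proof.
move=> fg df; have [cdf dfE] := (diff_locallyP _ _).1 df.
have gE : g \o shift x = cst (g x) + 'd f x +o_ 0 id.
  apply/eqaddoP => e e0.
  have := (eqaddoP _ _ _ _).1 dfE _ e0 => dfe.
  move: fg; rewrite (near_shift 0 x) subr0 => fg.
  have fgx : f x = g x by have := nbhs_singleton fg; rewrite /= add0r.
  apply: filterS2 fg dfe => y /= fgy; rewrite !fctE /= fgy fgx; exact.
apply/diff_locallyP; rewrite (diff_unique cdf gE); split => //.
Qed.

Section LocalDerivatives.
Variables (R : realType) (n : nat).
Implicit Types (f g : 'rV[R]_n -> R) (x y : 'rV[R]_n) (U : set 'rV[R]_n).

Lemma pderiv_near_eq f g i x :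
  (\forall y \near x, f y = g y) -> pderiv i f x = pderiv i g x.
Proof. exact: near_eq_derive. Qed.

Lemma pderiv_line f i x :
  pderiv i f x = derive1 (fun s => f (x + s *: delta_mx 0 i)) 0.
Proof.
rewrite /pderiv /derive /derive1.
apply: (congr1 (fun q : R -> R => lim (q @ 0^'))); apply/funext => h /=.
by rewrite addr0 scale0r addr0 [x + _]addrC.
Qed.

Lemma pderiv_cst (a : R) i : pderiv i (fun _ : 'rV[R]_n => a) = fun=> 0.
Proof. by apply/funext => x; exact: derive_cst. Qed.

Lemma pderiv_coord (i j : 'I_n) :
  pderiv i (fun x : 'rV[R]_n => x 0 j) = fun=> (i == j)%:R.
Proof.
apply/funext => x; rewrite pderiv_line derive1E.
pose c : R := (i == j)%:R.
have -> : (fun s : R => (x + s *: delta_mx 0 i) 0 j) =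
   cst (x 0 j) + (@id R * cst c).
  by apply/funext => s; rewrite !fctE !mxE eqxx eq_sym.
have := is_deriveD (is_derive_cst (x 0 j) (0 : R) (1 : R))
  (is_deriveM (is_derive_id (0 : R) 1) (is_derive_cst c (0 : R) 1)).
by case=> _ ->; rewrite scaler0 !add0r; exact: mulr1.
Qed.

Lemma pderivD f g i x : differentiable f x -> differentiable g x ->
  pderiv i (fun y => f y + g y) x = pderiv i f x + pderiv i g x.
Proof. by move=> df dg; apply: deriveD; exact: diff_derivable. Qed.

Lemma pderivM f g i x : differentiable f x -> differentiable g x ->
  pderiv i (fun y => f y * g y) x = f x * pderiv i g x + g x * pderiv i f x.
Proof. by move=> df dg; apply: deriveM; exact: diff_derivable. Qed.

(** Only the restriction of [phi] to the line matters, so [phi] may be factored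
    out without being differentiable; the volume density is used in this way. *)
Lemma pderiv_constM (phi : 'rV[R]_n -> R) f i x :
    (forall s : R, phi (x + s *: delta_mx 0 i) = phi x) -> differentiable f x ->
  pderiv i (fun y => phi y * f y) x = phi x * pderiv i f x.
Proof.
move=> phiE df; transitivity (pderiv i (fun y => phi x * f y) x).
  by rewrite !pderiv_line; congr derive1; apply/funext => s; rewrite phiE.
by rewrite pderivM ?pderiv_cst ?mulr0 ?addr0 //; exact: differentiable_cst.
Qed.

(** Smoothness quantifies over all iterated derivatives at once, and Leibniz'
    rule does not express a derivative of a product as a product.  Counting
    the order on a fixed set makes induction possible, with [diff_uptoS]
    peeling off the innermost derivative. *)
Definition diff_upto (m : nat) U f :=
  forall s : seq 'I_n, (size s <= m)%N ->
    forall y, U y -> differentiable (foldr (@pderiv R n) f s) y.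

Lemma diff_uptoS m U f : diff_upto m.+1 U f <->
  (forall y, U y -> differentiable f y) /\
  (forall i, diff_upto m U (pderiv i f)).
Proof.
split=> [df|[df dpf]].
- split=> [|i s sm]; first exact: (df [::]).
  by have := df (rcons s i); rewrite size_rcons foldr_rcons; exact.
- elim/last_ind => [//|s i _]; rewrite size_rcons foldr_rcons.
  exact: dpf.
Qed.

Lemma diff_upto_le m m' U f : (m <= m')%N -> diff_upto m' U f -> diff_upto m U f.
Proof. by move=> mm' df s sm; apply: df; exact: leq_trans mm'. Qed.

Lemma diff_upto_eq m U f g : open U -> (forall y, U y -> f y = g y) ->
  diff_upto m U f -> diff_upto m U g.
Proof.
move=> oU; elim: m f g => [|m IH] f g fg.
  move=> df [|//] _ y Uy /=; apply: near_eq_differentiable (df [::] _ y Uy) => //.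
  exact: filterS (open_nbhs_nbhs (conj oU Uy)).
move=> /diff_uptoS[df dpf]; apply/diff_uptoS; split.
- move=> y Uy; apply: near_eq_differentiable (df y Uy).
  exact: filterS (open_nbhs_nbhs (conj oU Uy)).
- move=> i; apply: IH (dpf i) => y Uy; apply: pderiv_near_eq.
  exact: filterS (open_nbhs_nbhs (conj oU Uy)).
Qed.

Lemma diff_uptoD m U f g : open U -> diff_upto m U f -> diff_upto m U g ->
  diff_upto m U (fun y => f y + g y).
Proof.
move=> oU; elim: m f g => [|m IH] f g.
  move=> df dg [|//] _ y Uy /=.
  by apply: differentiableD; [exact: (df [::])|exact: (dg [::])].
move=> /diff_uptoS[df dpf] /diff_uptoS[dg dpg]; apply/diff_uptoS; split.
  by move=> y Uy; apply: differentiableD; [exact: df|exact: dg].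
move=> i; apply: diff_upto_eq (IH _ _ (dpf i) (dpg i)) => // y Uy.
by rewrite pderivD //; [exact: df|exact: dg].
Qed.

Lemma diff_uptoM m U f g : open U -> diff_upto m U f -> diff_upto m U g ->
  diff_upto m U (fun y => f y * g y).
Proof.
move=> oU; elim: m f g => [|m IH] f g.
  move=> df dg [|//] _ y Uy /=.
  by apply: differentiableM; [exact: (df [::])|exact: (dg [::])].
move=> df0 dg0; have [df dpf] := (diff_uptoS m U f).1 df0.
have [dg dpg] := (diff_uptoS m U g).1 dg0; apply/diff_uptoS; split.
  by move=> y Uy; apply: differentiableM; [exact: df|exact: dg].
move=> i.
apply: (@diff_upto_eq _ _ (fun y => f y * pderiv i g y + g y * pderiv i f y)) => //.
  by move=> y Uy; rewrite pderivM //; [exact: df|exact: dg].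
apply: diff_uptoD => //; apply: IH => //.
- exact: diff_upto_le df0.
- exact: diff_upto_le dg0.
Qed.

Lemma smooth_nearP f x :
  smooth_near f x <-> exists U, [/\ open U, U x & forall m, diff_upto m U f].
Proof.
split.
- move=> /nbhs_interior; rewrite nbhsE => -[U [oU Ux] sU].
  exists U; split=> // m s sm y Uy.
  exact: (nbhs_singleton (sU y Uy) s).
- move=> [U [oU Ux dU]].
  apply: filterS (open_nbhs_nbhs (conj oU Ux)) => y Uy s.
  exact: (dU (size s)).
Qed.

Lemma smooth_near_eq f g x : (\forall y \near x, f y = g y) ->
  smooth_near f x -> smooth_near g x.
Proof.
move=> fg /smooth_nearP[U [oU Ux dU]].
move: fg => /nbhs_interior; rewrite nbhsE => -[V [oV Vx] sV].
have fg y : V y -> f y = g y by move=> /sV /nbhs_singleton.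
apply/smooth_nearP; exists (U `&` V); split => //; first exact: openI.
move=> m; apply: (@diff_upto_eq _ _ f) => //; first exact: openI.
  by move=> y [_ /fg].
by move=> s sm y [Uy _]; exact: dU sm y Uy.
Qed.

Lemma smooth_near_binop (op : R -> R -> R) f g x :
    (forall m U f' g', open U -> diff_upto m U f' -> diff_upto m U g' ->
      diff_upto m U (fun y => op (f' y) (g' y))) ->
  smooth_near f x -> smooth_near g x -> smooth_near (fun y => op (f y) (g y)) x.
Proof.
move=> opU /smooth_nearP[U [oU Ux dU]] /smooth_nearP[V [oV Vx dV]].
apply/smooth_nearP; exists (U `&` V); split => //; first exact: openI.
move=> m; apply: opU; first exact: openI.
- by move=> s sm y [Uy _]; exact: dU sm y Uy.
- by move=> s sm y [_ Vy]; exact: dV sm y Vy.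
Qed.

Lemma smooth_nearD f g x : smooth_near f x -> smooth_near g x ->
  smooth_near (fun y => f y + g y) x.
Proof. by apply: smooth_near_binop => m U f' g'; exact: diff_uptoD. Qed.

Lemma smooth_nearM f g x : smooth_near f x -> smooth_near g x ->
  smooth_near (fun y => f y * g y) x.
Proof. by apply: smooth_near_binop => m U f' g'; exact: diff_uptoM. Qed.

Lemma smooth_near_cst (a : R) x : smooth_near (fun=> a) x.
Proof.
apply: (@filterE _ (nbhs x)) => y s.
suff [b ->] : exists b, foldr (@pderiv R n) (fun=> a) s = fun=> b.
  exact: differentiable_cst.
elim: s => [|i s [b IH]] /=; first by exists a.
by exists 0; rewrite IH pderiv_cst.
Qed.

Lemma smooth_near_coord (j : 'I_n) x : smooth_near (fun y => y 0 j) x.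
Proof.
apply/smooth_nearP; exists setT; split => //; first exact: openT.
case=> [|m]; first by move=> [|//] _ y _; exact: differentiable_coord.
apply/diff_uptoS; split=> [y _|i]; first exact: differentiable_coord.
rewrite pderiv_coord => s sm y _.
exact: (nbhs_singleton (smooth_near_cst _ y)).
Qed.

Lemma smooth_near_sum (I : Type) (r : seq I) (F : I -> 'rV[R]_n -> R) x :
  (forall i, smooth_near (F i) x) -> smooth_near (fun y => \sum_(i <- r) F i y) x.
Proof.
move=> sF; elim: r => [|i r IH].
  by under [X in smooth_near X]eq_fun do rewrite big_nil; exact: smooth_near_cst.
under [X in smooth_near X]eq_fun do rewrite big_cons.
exact: smooth_nearD.
Qed.

Lemma smooth_near_differentiable f x : smooth_near f x -> differentiable f x.
Proof. by move=> /nbhs_singleton /(_ [::]). Qed.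

End LocalDerivatives.

(** For a map [phi] that sends each coordinate direction to a coordinate
    direction or to 0, no chain rule is needed: an iterated derivative of
    [f \o phi] is an iterated derivative of [f] composed with [phi], or 0. *)
Lemma smooth_near_comp (R : realType) (m n : nat) (phi : 'rV[R]_m -> 'rV[R]_n)
    (f : 'rV[R]_n -> R) x :
    (forall y, differentiable phi y) ->
    (forall i, (exists j, forall f, pderiv i (f \o phi) = pderiv j f \o phi) \/
               (forall f : 'rV[R]_n -> R, pderiv i (f \o phi) = fun=> 0)) ->
  smooth_near f (phi x) -> smooth_near (f \o phi) x.
Proof.
move=> dphi dE sf.
have : \forall y \near x, forall s : seq 'I_n,
    differentiable (foldr (@pderiv R n) f s) (phi y).
  exact: (differentiable_continuous (dphi x)) sf.
apply: filterS => y sfy s.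
have [[s' ->]|->] : (exists s', foldr (@pderiv R m) (f \o phi) s =
     foldr (@pderiv R n) f s' \o phi) \/
     foldr (@pderiv R m) (f \o phi) s = fun=> 0.
- elim: s => [|i s [[s' IH]|IH]] /=; first by left; exists [::].
  + rewrite IH; have [[j ->]|->] := dE i; [left|by right].
    by exists (j :: s').
  + by right; rewrite IH pderiv_cst.
- by apply: differentiable_comp.
- exact: differentiable_cst.
Qed.

(** The difference quotients agree, so no differentiability is involved. *)
Lemma pderiv_comp_linear (R : realType) (m n : nat) (phi : 'rV[R]_m -> 'rV[R]_n)
    (i : 'I_m) (v : 'rV[R]_n) (f : 'rV[R]_n -> R) :
    (forall (s : R) y, phi (s *: delta_mx 0 i + y) = s *: v + phi y) ->
  pderiv i (f \o phi) = fun y => 'D_v f (phi y).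
Proof.
move=> phiE; apply/funext => y; rewrite /pderiv /derive.
apply: (congr1 (fun q : R -> R => lim (q @ 0^'))); apply/funext => h /=.
by rewrite phiE.
Qed.

(** * Changes of variables between base and bundle coordinates *)

Section BlockCoordinates.
Variables (R : realType) (n k : nat).

Lemma pderiv_lsubmx_lshift (i : 'I_n) (f : 'rV[R]_n -> R) :
  pderiv (lshift k i) (f \o lsubmx) = pderiv i f \o lsubmx.
Proof.
apply: pderiv_comp_linear => s y; rewrite linearP /=; congr (_ *: _ + _).
by apply/rowP => j; rewrite !mxE eqxx eq_lshift.
Qed.

Lemma pderiv_lsubmx_rshift (a : 'I_k) (f : 'rV[R]_n -> R) :
  pderiv (rshift n a) (f \o lsubmx) = fun=> 0.
Proof.
rewrite (@pderiv_comp_linear _ _ _ _ _ 0) => [|s y].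
  by apply/funext => y; rewrite derive0.
rewrite linearP /=; congr (_ *: _ + _).
by apply/rowP => j; rewrite !mxE eqxx eq_lrshift.
Qed.

Lemma smooth_near_lsubmx (f : 'rV[R]_n -> R) (y : 'rV[R]_(n + k)) :
  smooth_near f (lsubmx y) -> smooth_near (f \o lsubmx) y.
Proof.
apply: smooth_near_comp => [z|i]; first exact: differentiable_lsubmx.
rewrite -(splitK i); case: (fintype.split i) => j /=.
- by left; exists j => g; exact: pderiv_lsubmx_lshift.
- by right => g; exact: pderiv_lsubmx_rshift.
Qed.

Variable u : 'rV[R]_k.

Let slice (x : 'rV[R]_n) : 'rV[R]_(n + k) := row_mx x u.

Lemma pderiv_row_mx i (f : 'rV[R]_(n + k) -> R) :
  pderiv i (f \o slice) = pderiv (lshift k i) f \o slice.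
Proof.
apply: pderiv_comp_linear => s y; apply/rowP => j.
rewrite !mxE eqxx; case: split_ordP => l ->; rewrite ?mxE ?eqxx /=.
- by rewrite eq_lshift.
- by rewrite eq_rlshift mulr0 add0r.
Qed.

Lemma differentiable_row_mx (x : 'rV[R]_n) : differentiable slice x.
Proof.
pose l (x : 'rV[R]_n) : 'rV[R]_(n + k) := row_mx x 0.
have -> : slice = l + cst (row_mx 0 u).
  by apply/funext => y; rewrite !fctE /l add_row_mx addr0 add0r.
apply: differentiableD; last exact: differentiable_cst.
have lL : linear l by move=> a y z; rewrite /l scale_row_mx add_row_mx scaler0 addr0.
pose lM := GRing.isLinear.Build _ _ _ _ _ lL.
pose lP : {linear _ -> _} := HB.pack l lM.
have -> : l = lP by [].
apply: linear_differentiable => {}x B /nbhs_ballP[e e0 eB].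
apply/nbhs_ballP; exists e => // z [_ xz]; apply: eB; split=> // i j.
rewrite /= /l !mxE; case: fintype.split => a; [exact: xz|exact: ballxx].
Qed.

Lemma smooth_near_row_mx (f : 'rV[R]_(n + k) -> R) (x : 'rV[R]_n) :
  smooth_near f (row_mx x u) -> smooth_near (fun z => f (row_mx z u)) x.
Proof.
apply: (@smooth_near_comp _ _ _ slice) => [z|i].
- exact: differentiable_row_mx.
- by left; exists (lshift k i) => g; exact: pderiv_row_mx.
Qed.

End BlockCoordinates.

(** * Determinants of positive definite and Gram matrices *)

Section PositiveDefinite.
Variable R : realFieldType.

Definition posdef n (A : 'M[R]_n) :=
  A^T = A /\ forall u : 'rV_n, u != 0 -> 0 < (u *m A *m u^T) 0 0.

(** Eliminating the first row and column of the block form [[a, b], [b^T, C]]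
    multiplies the determinant by [a > 0] and leaves the Schur complement
    [C - a^-1 b^T b], which is positive definite as its values are those of
    the original form at vectors whose first coordinate is optimal. *)
Lemma det_posdef n (A : 'M[R]_n) : posdef A -> 0 < \det A.
Proof.
elim: n A => [|n IH] A [symA posA]; first by rewrite det_mx00.
pose A' : 'M[R]_(1 + n) := A.
pose a := A 0 0.
pose b := ursubmx A'; pose C := drsubmx A'.
have AE : A' = block_mx a%:M b b^T C.
  rewrite -[LHS]submxK /b /C -[in dlsubmx A'](symA : A'^T = A') -trmx_ursub.
  congr block_mx; apply/matrixP => i j; rewrite !ord1 !mxE /a.
  by congr (A _ _); apply/val_inj.
have qE (x : R) (v : 'rV[R]_n) : let w := row_mx x%:M v : 'rV[R]_(1 + n) in
    (w *m A' *m w^T) 0 0 =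
    x * a * x + (v *m b^T) 0 0 * x + x * (b *m v^T) 0 0 + (v *m C *m v^T) 0 0.
  rewrite /= AE mul_row_block tr_row_mx mul_row_col !mulmxDl.
  rewrite tr_scalar_mx !mul_scalar_mx !mul_mx_scalar -scalemxAl !mxE eqxx mulr1n.
  by ring.
have a_gt0 : 0 < a.
  have := posA (row_mx 1 0 : 'rV[R]_(1 + n)).
  have -> : (1 : 'M[R]_1) = 1%:M by [].
  rewrite qE !mul0mx trmx0 mulmx0 !mxE !mulr0 mul0r !addr0 mulr1 mul1r.
  by apply; rewrite (@row_mx_eq0 _ 1 1 n) negb_and oner_neq0.
pose S := C - a^-1 *: (b^T *m b).
have -> : \det A = a * \det S.
  pose L : 'M[R]_(1 + n) := block_mx 1%:M 0 (- a^-1 *: b^T) 1%:M.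
  have detL : \det L = 1 by rewrite det_lblock !det1 mulr1.
  rewrite -[LHS]mul1r -detL -det_mulmx -/A' AE mulmx_block.
  rewrite !mul1mx !mul0mx !addr0 mul_mx_scalar scalerA mulrN mulfV ?gt_eqF //.
  rewrite scaleN1r addNr det_ublock det_scalar1 -scalemxAl scaleNr.
  by rewrite [- _ + _]addrC.
rewrite mulr_gt0 //; apply: IH; split.
  rewrite /S linearB /= linearZ /= trmx_mul trmxK; congr (_ - _).
  by rewrite /C trmx_drsub (symA : A'^T = A').
move=> v v0.
(* the first coordinate that minimizes the quadratic form, given [v] *)
have := posA (row_mx (- (a^-1 * (v *m b^T) 0 0))%:M v : 'rV[R]_(1 + n)).
rewrite qE /S mulmxBr mulmxBl -scalemxAr -scalemxAl.
have -> : v *m (b^T *m b) *m v^T = (v *m b^T) *m (b *m v^T) by rewrite !mulmxA.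
have -> : (b *m v^T) 0 0 = (v *m b^T) 0 0.
  by rewrite -[b *m v^T]trmxK trmx_mul trmxK mxE.
have -> : ((v *m C *m v^T) - a^-1 *: (v *m b^T *m (b *m v^T))) 0 0 =
   (v *m C *m v^T) 0 0 - a^-1 * ((v *m b^T) 0 0 * (v *m b^T) 0 0).
  rewrite [LHS]mxE; congr (_ + _).
  rewrite [LHS]mxE [X in - X]mxE [X in _ * X]mxE big_ord1.
  congr (- (_ * (_ * _))).
  by rewrite -[b *m v^T]trmxK trmx_mul trmxK mxE.
set z := (v *m b^T) 0 0; set q := (v *m C *m v^T) 0 0.
have -> : - (a^-1 * z) * a * - (a^-1 * z) + z * - (a^-1 * z) +
   - (a^-1 * z) * z + q = q - a^-1 * (z * z) + (a^-1 * a - 1) * a^-1 * z * z by ring.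
rewrite mulVf ?gt_eqF // subrr !mul0r addr0; apply.
by rewrite (@row_mx_eq0 _ 1 1 n) negb_and v0 orbT.
Qed.

(** The matrix is congruent to [block_mx P 0 0 Q] by a unipotent matrix. *)
Lemma det_congr_block n k (P : 'M[R]_n) (Q : 'M[R]_k) (N : 'M[R]_(n, k)) :
  \det (block_mx (P + N *m Q *m N^T) (N *m Q) (Q *m N^T) Q) = \det P * \det Q.
Proof.
have -> : block_mx (P + N *m Q *m N^T) (N *m Q) (Q *m N^T) Q =
  block_mx 1%:M N 0 1%:M *m block_mx P 0 0 Q *m block_mx 1%:M 0 N^T 1%:M.
  by rewrite !mulmx_block !mul1mx !mul0mx !mulmx0 !mulmx1 !addr0 !add0r.
by rewrite !det_mulmx !det_ublock det_lblock !det1 !mul1r !mulr1.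
Qed.

End PositiveDefinite.

Section InnerProducts.
Variables (R : realType) (V : lmodType R) (S : set V) (b : V -> V -> R).
Hypothesis bS : inner_product_on S b.
Hypothesis S0 : S 0.
Hypothesis S_lin : forall (a : R) u w, S u -> S w -> S (a *: u + w).

Lemma inner0l w : S w -> b 0 w = 0.
Proof.
move=> Sw; have := inner_linear bS 1 S0 S0 Sw.
rewrite scaler0 addr0 mul1r => /eqP.
by rewrite -subr_eq0 opprD addNKr oppr_eq0 => /eqP.
Qed.

Lemma inner0r w : S w -> b w 0 = 0.
Proof. by move=> Sw; rewrite (inner_sym bS) // inner0l. Qed.

Lemma inner_ge0 w : S w -> 0 <= b w w.
Proof.
move=> Sw; have [->|w0] := eqVneq w 0; first by rewrite inner0l.
exact: ltW (inner_pos bS Sw w0).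
Qed.

Section Combinations.
Variables (n : nat) (v : 'I_n -> V).
Hypothesis Sv : forall i, S (v i).

Lemma comb_closed (u : 'I_n -> R) : S (\sum_i u i *: v i).
Proof.
elim/big_ind: _ => // [x y Sx Sy|i _].
- by rewrite -[x]scale1r; exact: S_lin.
- by rewrite -[_ *: _]addr0; exact: S_lin.
Qed.

Lemma inner_suml (u : 'I_n -> R) w : S w ->
  b (\sum_i u i *: v i) w = \sum_i u i * b (v i) w.
Proof.
move=> Sw; suff [//] : b (\sum_i u i *: v i) w = \sum_i u i * b (v i) w /\
    S (\sum_i u i *: v i).
elim/big_ind2: _ => [|_ x _ y [<- Sx] [<- Sy]|i _].
- by rewrite inner0l.
- split; last by rewrite -[x]scale1r; exact: S_lin.
  by rewrite -[in LHS](scale1r x) (inner_linear bS) // mul1r.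
- split; last by rewrite -[_ *: _]addr0; exact: S_lin.
  by rewrite -[in LHS](addr0 (_ *: _)) (inner_linear bS) // inner0l // addr0.
Qed.

Lemma inner_sumr (u : 'I_n -> R) w : S w ->
  b w (\sum_i u i *: v i) = \sum_i u i * b w (v i).
Proof.
move=> Sw; rewrite (inner_sym bS) //; last exact: comb_closed.
by rewrite inner_suml //; apply: eq_bigr => i _; rewrite (inner_sym bS).
Qed.

Lemma det_gram_gt0 :
    (forall u : 'I_n -> R, \sum_i u i *: v i = 0 -> forall i, u i = 0) ->
  0 < \det (\matrix_(i, j) b (v i) (v j)).
Proof.
move=> free_v; apply: det_posdef; split.
  by apply/matrixP => i j; rewrite !mxE (inner_sym bS).
move=> u u0; set w := \sum_i u 0 i *: v i.
suff -> : (u *m (\matrix_(i, j) b (v i) (v j)) *m u^T) 0 0 = b w w.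
  apply: (inner_pos bS); first exact: comb_closed.
  by apply: contra_neq u0 => /free_v u0; apply/rowP => i; rewrite u0 mxE.
rewrite inner_sumr; last exact: comb_closed.
rewrite mxE; apply: eq_bigr => j _; rewrite mxE mulrC mxE; congr (_ * _).
by rewrite inner_suml //; apply: eq_bigr => i _; rewrite mxE.
Qed.

End Combinations.
End InnerProducts.

(** * Tangent vectors and coordinate vectors *)

Section TangentVectors.
Variables (R : realType) (n : nat) (X : Type) (A : set (chart R n X)).
Implicit Types (p : X) (v w : functional R X) (f g : X -> R).

Lemma smooth_at_linear p (a : R) f g : smooth_at A p f -> smooth_at A p g ->
  smooth_at A p (fun q => a * f q + g q).
Proof.
move=> sf sg c Ac cp; apply: smooth_nearD (sg c Ac cp).
exact: smooth_nearM (smooth_near_cst _ _) (sf c Ac cp).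
Qed.

Lemma smooth_at_mul p f g : smooth_at A p f -> smooth_at A p g ->
  smooth_at A p (fun q => f q * g q).
Proof. by move=> sf sg c Ac cp; exact: smooth_nearM (sf c Ac cp) (sg c Ac cp). Qed.

Lemma restrict_smoothT p (v : (X -> R) -> R) f :
  smooth_at A p f -> restrict_smooth A p v f = v f.
Proof. by move=> sf; rewrite /restrict_smooth; case: asboolP. Qed.

Lemma eq_restrict_smooth p (v w : (X -> R) -> R) :
    (forall f, smooth_at A p f -> v f = w f) ->
  restrict_smooth A p v = restrict_smooth A p w.
Proof.
by move=> vw; apply/funext => f; rewrite /restrict_smooth; case: asboolP => // /vw.
Qed.

Lemma tangent_lin p (a : R) v w : tangent A p v -> tangent A p w ->
  tangent A p (a *: v + w).
Proof.
have lE f : (a *: v + w) f = a * v f + w f by [].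
move=> tv tw; split=> [f nf|b f g sf sg|f g sf sg]; rewrite !lE.
- by rewrite (tangent_nonsmooth tv) // (tangent_nonsmooth tw) // mulr0 addr0.
- by rewrite (tangent_linear tv) // (tangent_linear tw) //; ring.
- by rewrite (tangent_leibniz tv) // (tangent_leibniz tw) //; ring.
Qed.

Lemma tangent0 p : tangent A p 0.
Proof.
have zE f : (0 : functional R X) f = 0 by [].
by split=> [f nf|b f g sf sg|f g sf sg]; rewrite !zE // !mulr0 addr0.
Qed.

Lemma coord_vec_tangent c i p : A c -> cdom c p -> cinv c (cmap c p) = p ->
  tangent A p (coord_vec A c i p).
Proof.
move=> Ac cp cK.
have df f : smooth_at A p f -> differentiable (f \o cinv c) (cmap c p).
  by move=> sf; apply: smooth_near_differentiable; exact: sf.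
split=> [f nf|a f g sf sg|f g sf sg].
- by rewrite /coord_vec /restrict_smooth; case: asboolP.
- rewrite /coord_vec !restrict_smoothT //; last exact: smooth_at_linear.
  rewrite (@pderivD _ _ (fun y => a * f (cinv c y)) (g \o cinv c)); last exact: df.
    rewrite (@pderivM _ _ (fun=> a) (f \o cinv c)); last exact: df.
      by rewrite pderiv_cst mulr0 addr0.
    exact: differentiable_cst.
  by apply: (@differentiableM _ _ (fun=> a)); [exact: differentiable_cst|exact: df].
- rewrite /coord_vec !restrict_smoothT //; last exact: smooth_at_mul.
  rewrite (@pderivM _ _ (f \o cinv c) (g \o cinv c)) /= ?cK //; exact: df.
Qed.

End TangentVectors.

Section Manifold.
Variables (R : realType) (n : nat) (M : topologicalType) (A : set (chart R n M)).
Hypothesis hM : smooth_manifold A.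

Lemma ccod_near c p : A c -> cdom c p -> \forall x \near cmap c p, ccod c x.
Proof.
move=> Ac cp; apply: (open_nbhs_nbhs (conj (atlas_open_cod hM Ac) _)).
by exists p.
Qed.

Lemma ccodP c x : A c -> ccod c x -> cdom c (cinv c x) /\ cmap c (cinv c x) = x.
Proof. by move=> Ac [p cp <-]; rewrite (atlas_mapK hM). Qed.

(** Properties that hold near a point of the manifold transfer to coordinates,
    where smoothness is tested. *)
Lemma near_chart c p (Q : M -> Prop) : A c -> cdom c p ->
  (\forall q \near p, Q q) -> \forall x \near cmap c p, Q (cinv c x).
Proof.
move=> Ac cp; have := atlas_inv_cont hM Ac.
rewrite continuous_open_subspace; last exact: (atlas_open_cod hM Ac).
move=> /(_ (cmap c p)); rewrite inE => cont nQ.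
by apply: (cont (ex_intro2 _ _ p cp erefl)); rewrite (atlas_mapK hM).
Qed.

Lemma smooth_at_near_eq p (f g : M -> R) :
  (\forall q \near p, f q = g q) -> smooth_at A p f -> smooth_at A p g.
Proof.
move=> fg sf c Ac cp; apply: smooth_near_eq (sf c Ac cp).
exact: near_chart Ac cp fg.
Qed.

Lemma coord_vec_coord c i j p : A c -> cdom c p ->
  coord_vec A c i p (fun q => cmap c q 0 j) = (i == j)%:R.
Proof.
move=> Ac cp; rewrite /coord_vec restrict_smoothT; last exact: atlas_compat.
rewrite (@pderiv_near_eq _ _ _ (fun x => x 0 j)) ?pderiv_coord //.
by apply: filterS (ccod_near Ac cp) => x /(ccodP Ac)[_ /= ->].
Qed.

(** Evaluating the combination at the coordinate functions of the chart gives
    its coefficients. *)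
Lemma coord_vec_free c p (u : 'I_n -> R) : A c -> cdom c p ->
  \sum_i u i *: coord_vec A c i p = 0 -> forall i, u i = 0.
Proof.
move=> Ac cp sum0 j.
have sumE f : (\sum_i u i *: coord_vec A c i p) f = \sum_i u i * coord_vec A c i p f.
  by elim/big_ind2: _ => // _ a _ b <- <-.
have := sumE (fun q => cmap c q 0 j); rewrite sum0 (bigD1 j) //= big1.
  by rewrite coord_vec_coord // eqxx mulr1 addr0.
by move=> i ij; rewrite coord_vec_coord // (negbTE ij) mulr0.
Qed.

Lemma det_gram_metric_gt0 (g : M -> functional R M -> functional R M -> R) c p :
  riemannian_metric A g -> A c -> cdom c p -> 0 < \det (gram A g c p).
Proof.
move=> hg Ac cp; apply: (det_gram_gt0 (riemannian_inner hg p)).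
- exact: tangent0.
- by move=> a u w; exact: tangent_lin.
- by move=> i; apply: coord_vec_tangent => //; exact: (atlas_mapK hM).
- by move=> u; exact: coord_vec_free.
Qed.

End Manifold.

(** * Local coordinates of a vector bundle *)

Section VectorBundle.
Variables (R : realType) (n k : nat) (M : topologicalType).
Variables (A : set (chart R n M)) (E : M -> lmodType R).
Variable T : set (trivialization k E).
Hypothesis hM : smooth_manifold A.
Hypothesis hE : vector_bundle A T.

Local Notation AE := (total_atlas A T).
Implicit Types (t : trivialization k E) (c : chart R n M) (p : M) (u : 'rV[R]_k).

Lemma tinv_linear t p : T t -> tdom t p -> linear (tinv t p).
Proof.
move=> Tt tp a u w; apply: (can_inj (bundle_mapK hE Tt tp)).
by rewrite (bundle_linear hE Tt tp) !(bundle_invK hE Tt tp).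
Qed.

Lemma tinv_sum t p u : T t -> tdom t p ->
  tinv t p u = \sum_a u 0 a *: frame t a p.
Proof.
move=> Tt tp.
pose lM := GRing.isLinear.Build _ _ _ _ _ (tinv_linear Tt tp).
pose l : {linear _ -> _} := HB.pack (tinv t p) lM.
rewrite -[tinv t p]/(l : _ -> _) {1}(row_sum_delta u) linear_sum.
by apply: eq_bigr => a _; rewrite linearZ.
Qed.

Lemma tmap_sum t p (w : 'I_k -> E p) (u : 'I_k -> R) b : T t -> tdom t p ->
  tmap t (\sum_a u a *: w a) 0 b = \sum_a u a * tmap t (w a) 0 b.
Proof.
move=> Tt tp.
pose lM := GRing.isLinear.Build _ _ _ _ _ (bundle_linear hE Tt tp).
pose l : {linear _ -> _} := HB.pack (@tmap _ _ _ _ t p) lM.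
rewrite -[@tmap _ _ _ _ t p]/(l : _ -> _) linear_sum summxE.
by apply: eq_bigr => a _; rewrite linearZ mxE.
Qed.

Lemma frame_free t p (u : 'I_k -> R) : T t -> tdom t p ->
  \sum_a u a *: frame t a p = 0 -> forall a, u a = 0.
Proof.
move=> Tt tp sum0 a.
have tmap0 : tmap t (0 : E p) = 0.
  have := bundle_linear hE Tt tp 1 (0 : E p) 0; rewrite !scale1r addr0.
  by move=> /eqP; rewrite -subr_eq0 opprD addNKr oppr_eq0 => /eqP.
have := tmap_sum (fun a => frame t a p) u a Tt tp.
rewrite sum0 tmap0 mxE (bigD1 a) //= big1 => [|b ba].
  by rewrite /frame (bundle_invK hE Tt tp) mxE !eqxx mulr1 addr0.
by rewrite /frame (bundle_invK hE Tt tp) mxE eq_sym (negbTE ba) andbF mulr0.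
Qed.

Lemma total_atlasE c t : A c -> T t -> AE (total_chart c t).
Proof. by move=> Ac Tt; exists c, t. Qed.

Lemma total_chart_inv c t p u : A c -> cdom c p ->
  cinv (total_chart c t) (row_mx (cmap c p) u) = in_fiber (tinv t p u).
Proof. by move=> Ac cp /=; rewrite row_mxKl row_mxKr (atlas_mapK hM). Qed.

Lemma total_chart_map c t p u : T t -> tdom t p ->
  cmap (total_chart c t) (in_fiber (tinv t p u)) = row_mx (cmap c p) u.
Proof. by move=> Tt tp /=; rewrite (bundle_invK hE). Qed.

(** Writing every point in this form keeps the base point fixed
    definitionally, which avoids transporting vectors between equal fibers. *)
Lemma in_fiber_tinv t (e : total_space E) : T t -> tdom t (bundle_proj e) ->
  e = in_fiber (tinv t (bundle_proj e) (tmap t (projT2 e))).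
Proof. by move=> Tt te; rewrite (bundle_mapK hE) //; case: e te. Qed.

Lemma total_chart_near c t p u : A c -> T t -> cdom c p -> tdom t p ->
  \forall y \near (row_mx (cmap c p) u : 'rV[R]_(n + k)),
    let q := cinv c (lsubmx y) in
    [/\ cdom c q, tdom t q & cmap c q = lsubmx y].
Proof.
move=> Ac Tt cp tp.
have : \forall x \near cmap c p, [/\ cdom c (cinv c x), tdom t (cinv c x) &
    cmap c (cinv c x) = x].
  have tdom_near : \forall q \near p, tdom t q.
    exact: open_nbhs_nbhs (conj (bundle_open hE Tt) tp).
  apply: filterS2 (ccod_near hM Ac cp) (near_chart hM Ac cp tdom_near).
  by move=> x /(ccodP hM Ac)[? ?] ?.
rewrite -[X in nbhs X _ -> _](row_mxKl (cmap c p) u).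
exact: continuous_lsubmx.
Qed.

Lemma smooth_at_bundle_proj (e : total_space E) (f : M -> R) :
  smooth_at A (bundle_proj e) f -> smooth_at AE e (f \o @bundle_proj R M E).
Proof.
move=> sf _ [c [t [Ac Tt ->]]] [ce te].
apply: (@smooth_near_lsubmx _ _ _ (f \o cinv c)).
by rewrite /= row_mxKl; exact: sf.
Qed.

(** In the chart of the total space built on [t], this section with constant
    components is the affine map [x |-> (x, u)]. *)
Lemma smooth_at_section t p u (f : total_space E -> R) : T t -> tdom t p ->
  smooth_at AE (in_fiber (tinv t p u)) f ->
  smooth_at A p (fun q => f (in_fiber (tinv t q u))).
Proof.
move=> Tt tp sf c Ac cp.
have := sf _ (total_atlasE Ac Tt) (conj cp tp).
rewrite total_chart_map // => /smooth_near_row_mx.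
congr smooth_near; apply/funext => x /=.
by rewrite row_mxKl row_mxKr.
Qed.

(** In another trivialization its components are constant combinations of the
    transition functions. *)
Lemma smooth_section_tinv t p u : T t -> tdom t p ->
  smooth_section_at A T p (fun q => tinv t q u).
Proof.
move=> Tt tp t' b Tt' tp'.
pose F q := \sum_a u 0 a * tmap t' (frame t a q) 0 b.
apply: (@smooth_at_near_eq _ _ _ _ hM _ F).
  have tdom_near : \forall q \near p, tdom t q.
    exact: open_nbhs_nbhs (conj (bundle_open hE Tt) tp).
  have tdom_near' : \forall q \near p, tdom t' q.
    exact: open_nbhs_nbhs (conj (bundle_open hE Tt') tp').
  apply: filterS2 tdom_near tdom_near' => q tq t'q.
  by rewrite (tinv_sum u Tt tq) (tmap_sum _ _ _ Tt' t'q).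
move=> c Ac cp; apply: smooth_near_sum => a; apply: smooth_nearM.
  exact: smooth_near_cst.
exact: (bundle_compat hE).
Qed.

End VectorBundle.

(** * The squared norm and the coordinate vectors of the total space *)

Section BundleMetric.
Variables (R : realType) (n k : nat) (M : topologicalType).
Variables (A : set (chart R n M)) (E : M -> lmodType R).
Variable T : set (trivialization k E).
Hypothesis hM : smooth_manifold A.
Hypothesis hE : vector_bundle A T.
Variable h : forall p, E p -> E p -> R.
Hypothesis hh : fiber_metric A T h.

Local Notation AE := (total_atlas A T).
Local Notation r := (fiber_sqnorm h).
Implicit Types (t : trivialization k E) (c : chart R n M) (p : M) (u : 'rV[R]_k).

Definition frame_gram t p : 'M[R]_k :=
  \matrix_(a, b) h (frame t a p) (frame t b p).

Lemma fiber_metric_linear p (a : R) (x y z : E p) :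
  h (a *: x + y) z = a * h x z + h y z.
Proof. exact: (inner_linear (fiber_inner hh p)). Qed.

Lemma fiber_metric_sym p (x y : E p) : h x y = h y x.
Proof. exact: (inner_sym (fiber_inner hh p)). Qed.

Lemma fiber_metric_suml p (I : finType) (a : I -> R) (x : I -> E p) y :
  h (\sum_i a i *: x i) y = \sum_i a i * h (x i) y.
Proof.
have h0 : h 0 y = 0.
  by apply: (inner0l (fiber_inner hh p)).
elim/big_ind2: _ => // [_ x1 _ x2 <- <-|i _].
- by rewrite -[in LHS](scale1r x1) fiber_metric_linear mul1r.
- by rewrite -[in LHS](addr0 (_ *: _)) fiber_metric_linear h0 addr0.
Qed.

Lemma fiber_metric_sumr p (I : finType) (a : I -> R) (x : I -> E p) y :
  h y (\sum_i a i *: x i) = \sum_i a i * h y (x i).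
Proof.
rewrite fiber_metric_sym fiber_metric_suml.
by apply: eq_bigr => i _; rewrite fiber_metric_sym.
Qed.

Lemma fiber_sqnorm_ge0 (e : total_space E) : 0 <= r e.
Proof. by apply: (inner_ge0 (fiber_inner hh _)). Qed.

Lemma fiber_sqnorm_tinv t p u : T t -> tdom t p ->
  r (in_fiber (tinv t p u)) =
  \sum_a \sum_b (u 0 a * u 0 b) * h (frame t a p) (frame t b p).
Proof.
move=> Tt tp; rewrite /fiber_sqnorm /= (tinv_sum hE u Tt tp) fiber_metric_suml.
apply: eq_bigr => a _; rewrite fiber_metric_sumr mulr_sumr.
by apply: eq_bigr => b _; rewrite mulrA.
Qed.

Lemma det_frame_gram_gt0 t p : T t -> tdom t p -> 0 < \det (frame_gram t p).
Proof.
move=> Tt tp; apply: (det_gram_gt0 (fiber_inner hh p)) => // u.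
exact: (frame_free hE).
Qed.

(** In coordinates it is the polynomial [h_ab (x) u_a u_b] in [u]. *)
Lemma fiber_sqnorm_smooth e : smooth_at AE e r.
Proof.
move=> _ [c [t [Ac Tt ->]]] [ce te].
pose F (y : 'rV[R]_(n + k)) := \sum_a \sum_b (y 0 (rshift n a) * y 0 (rshift n b)) *
  ((fun q => h (frame t a q) (frame t b q)) \o cinv c \o lsubmx) y.
apply: (@smooth_near_eq _ _ F).
  have := total_chart_near hM hE (tmap t (projT2 e)) Ac Tt ce te.
  apply: filterS => y /= [_ tq _]; rewrite fiber_sqnorm_tinv //.
  by apply: eq_bigr => a _; apply: eq_bigr => b _; rewrite !mxE.
apply: smooth_near_sum => a; apply: smooth_near_sum => b; apply: smooth_nearM.
  by apply: smooth_nearM; exact: smooth_near_coord.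
apply: smooth_near_lsubmx => /=; rewrite row_mxKl.
exact: (fiber_smooth hh).
Qed.

Lemma tangent_proj_horizontal c t p u i : A c -> T t -> cdom c p -> tdom t p ->
  tangent_map A (@bundle_proj R M E) (in_fiber (tinv t p u))
    (coord_vec AE (total_chart c t) (lshift k i) (in_fiber (tinv t p u))) =
  coord_vec A c i p.
Proof.
move=> Ac Tt cp tp; apply: eq_restrict_smooth => f sf.
rewrite /coord_vec restrict_smoothT; last exact: smooth_at_bundle_proj.
rewrite (total_chart_map hE) // (@pderiv_lsubmx_lshift _ _ _ _ (f \o cinv c)) /=.
by rewrite row_mxKl.
Qed.

Lemma tangent_proj_vertical c t p u a : A c -> T t -> cdom c p -> tdom t p ->
  tangent_map A (@bundle_proj R M E) (in_fiber (tinv t p u))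
    (coord_vec AE (total_chart c t) (rshift n a) (in_fiber (tinv t p u))) = 0.
Proof.
move=> Ac Tt cp tp.
rewrite (_ : 0 = restrict_smooth A p (fun=> 0)); last first.
  by apply/funext => f; rewrite /restrict_smooth; case: asboolP.
apply: eq_restrict_smooth => f sf.
rewrite /coord_vec restrict_smoothT; last exact: smooth_at_bundle_proj.
by rewrite (@pderiv_lsubmx_rshift _ _ _ _ (f \o cinv c)).
Qed.

(** This and [horizontal_lift_section] put the coordinate vectors of the total
    space in the two forms on which the connection map is prescribed. *)
Lemma vertical_lift_frame c t p u a : A c -> T t -> cdom c p -> tdom t p ->
  coord_vec AE (total_chart c t) (rshift n a) (in_fiber (tinv t p u)) =
  vertical_lift A T (tinv t p u) (frame t a p).
Proof.
move=> Ac Tt cp tp; apply: eq_restrict_smooth => f sf.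
rewrite (total_chart_map hE) // pderiv_line; congr derive1; apply/funext => s.
rewrite -[LHS]/(f (cinv (total_chart c t) _)).
have -> : row_mx (cmap c p) u + s *: delta_mx 0 (rshift n a) =
   row_mx (cmap c p) (s *: delta_mx 0 a + u).
  apply/rowP => j; rewrite !mxE eqxx; case: split_ordP => b ->; rewrite ?mxE ?eqxx.
  - by rewrite eq_lrshift mulr0 addr0.
  - by rewrite eq_rshift addrC.
by rewrite (total_chart_inv hM) // (tinv_linear hE Tt tp) addrC.
Qed.

Lemma horizontal_lift_section c t p u i : A c -> T t -> cdom c p -> tdom t p ->
  coord_vec AE (total_chart c t) (lshift k i) (in_fiber (tinv t p u)) =
  tangent_map AE (fun q => in_fiber (tinv t q u)) p (coord_vec A c i p).
Proof.
move=> Ac Tt cp tp; apply: eq_restrict_smooth => f sf.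
rewrite /coord_vec restrict_smoothT; last exact: (smooth_at_section hE).
rewrite (total_chart_map hE) //.
have := congr1 (@^~ (cmap c p)) (pderiv_row_mx u i (f \o cinv (total_chart c t))).
rewrite /= => <-; congr pderiv; apply/funext => x /=.
by rewrite row_mxKl row_mxKr.
Qed.

(** Along the line [e + s w], [r] is a polynomial of degree 2 in [s]. *)
Lemma pderiv_sqnorm_vertical c t p u a : A c -> T t -> cdom c p -> tdom t p ->
  pderiv (rshift n a) (r \o cinv (total_chart c t)) (row_mx (cmap c p) u) =
  2 * h (frame t a p) (tinv t p u).
Proof.
move=> Ac Tt cp tp.
have := congr1 (@^~ r) (vertical_lift_frame u a Ac Tt cp tp).
rewrite /coord_vec /vertical_lift !restrict_smoothT; try exact: fiber_sqnorm_smooth.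
rewrite (total_chart_map hE) // => ->.
pose w := frame t a p; pose e := tinv t p u.
have -> : (fun s : R => r (in_fiber (e + s *: w))) =
   horner ((h w w) *: 'X^2 + (2 * h w e) *: 'X + (h e e)%:P).
  apply/funext => s; rewrite !hornerE /fiber_sqnorm /= addrC.
  rewrite fiber_metric_linear ![h _ (s *: w + e)]fiber_metric_sym.
  rewrite !fiber_metric_linear [h e w]fiber_metric_sym; ring.
rewrite derive1E derive_val !derivD !derivZ derivXn derivX derivC.
by rewrite !hornerE ?mulr0n ?mul0rn ?mulr0 ?add0r.
Qed.

End BundleMetric.

(** * The Sasaki metric and the Laplacian of radial functions *)

Section Laplacian.
Variables (R : realType) (n k : nat) (M : topologicalType).
Variables (A : set (chart R n M)) (E : M -> lmodType R).
Variable T : set (trivialization k E).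
Hypothesis hM : smooth_manifold A.
Hypothesis hE : vector_bundle A T.
Variable g : M -> functional R M -> functional R M -> R.
Hypothesis hg : riemannian_metric A g.
Variable h : forall p, E p -> E p -> R.
Hypothesis hh : fiber_metric A T h.
Variable D : forall p, functional R M -> (forall q, E q) -> E p.
Hypothesis hDh : compatible A T D h.
Variable K : forall e : total_space E,
  functional R (total_space E) -> E (bundle_proj e).
Hypothesis hK : connection_map A T D K.

Local Notation AE := (total_atlas A T).
Local Notation r := (fiber_sqnorm h).
Local Notation G := (spherically_symmetric_metric A g h K (fun=> 0) (fun=> 0)).

Lemma sasaki_metricE e X Y : G e X Y =
  g (bundle_proj e) (tangent_map A (@bundle_proj R M E) e X)
                    (tangent_map A (@bundle_proj R M E) e Y) + h (K e X) (K e Y).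
Proof. by rewrite /spherically_symmetric_metric mulr0 expR0 !mul1r. Qed.

Section AtPoint.
Variables (c : chart R n M) (t : trivialization k E) (p : M) (u : 'rV[R]_k).
Hypothesis Ac : A c.
Hypothesis Tt : T t.
Hypothesis cp : cdom c p.
Hypothesis tp : tdom t p.

Let C := total_chart c t.
Let e : total_space E := in_fiber (tinv t p u).
Let Y : 'rV[R]_(n + k) := row_mx (cmap c p) u.
Let hor i := coord_vec AE C (lshift k i) e.
Let ver a := coord_vec AE C (rshift n a) e.

Lemma connection_map_ver a : K e (ver a) = frame t a p.
Proof.
rewrite /ver (vertical_lift_frame hM hE) //.
exact: (connection_map_vertical hK).
Qed.

Lemma connection_map_hor i :
  K e (hor i) = D p (coord_vec A c i p) (fun q => tinv t q u).
Proof.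
rewrite /hor (horizontal_lift_section hE) //.
apply: (connection_map_section hK).
- by apply: coord_vec_tangent => //; exact: (atlas_mapK hM).
- exact: (smooth_section_tinv hM hE).
Qed.

(** This is where the compatibility of [D] with [h] enters: both sides are the
    derivative of [h(s,s)] along [d/dx_i], for the section [s] with constant
    components through [e]. *)
Lemma pderiv_sqnorm_horizontal i :
  pderiv (lshift k i) (r \o cinv C) Y = 2 * h (K e (hor i)) (tinv t p u).
Proof.
have sr : smooth_at AE e r := fiber_sqnorm_smooth hM hE hh (e := e).
have := congr1 (@^~ r) (horizontal_lift_section hE u i Ac Tt cp tp).
rewrite /tangent_map [RHS]restrict_smoothT // [LHS]restrict_smoothT //.
rewrite (total_chart_map hE) // => ->.
have sm := smooth_section_tinv hM hE u Tt tp.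
have tv : tangent A p (coord_vec A c i p).
  by apply: coord_vec_tangent => //; exact: (atlas_mapK hM).
rewrite connection_map_hor.
have := hDh tv sm sm; rewrite /fiber_sqnorm /comp /= => ->.
by rewrite [X in _ + X](fiber_metric_sym hh) mulr_natl.
Qed.

Lemma gram_hor i j : gram AE G C e (lshift k i) (lshift k j) =
  gram A g c p i j + h (K e (hor i)) (K e (hor j)).
Proof. by rewrite !mxE sasaki_metricE !(tangent_proj_horizontal hE). Qed.

Lemma tangent_proj_coord_vec j :
  tangent A p (tangent_map A (@bundle_proj R M E) e (coord_vec AE C j e)).
Proof.
case: (split_ordP j) => i ->.
- rewrite (tangent_proj_horizontal hE) //.
  by apply: coord_vec_tangent => //; exact: (atlas_mapK hM).
- rewrite tangent_proj_vertical //; exact: tangent0.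
Qed.

Lemma gram_ver j a : gram AE G C e j (rshift n a) =
  h (K e (coord_vec AE C j e)) (frame t a p).
Proof.
rewrite mxE sasaki_metricE -/(ver a) connection_map_ver.
rewrite [tangent_map _ _ _ (ver a)]tangent_proj_vertical //.
rewrite (inner0r (riemannian_inner hg p)) ?add0r //; first exact: tangent0.
exact: tangent_proj_coord_vec.
Qed.

Lemma gram_sym i j : gram AE G C e i j = gram AE G C e j i.
Proof.
rewrite !mxE !sasaki_metricE (fiber_metric_sym hh); congr (_ + _).
by apply: (inner_sym (riemannian_inner hg p)); exact: tangent_proj_coord_vec.
Qed.

(** [N i b] is the coefficient [Gamma_ia^b u^a] formed from the Christoffel
    symbols, but only its value at the given point is ever used. *)
Let N : 'M[R]_(n, k) := \matrix_(i, b) tmap t (K e (hor i)) 0 b.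

Lemma connection_map_hor_frame i : K e (hor i) = \sum_b N i b *: frame t b p.
Proof.
rewrite -[LHS](bundle_mapK hE Tt tp) (tinv_sum hE) //.
by apply: eq_bigr => b _; rewrite mxE.
Qed.

Lemma gram_block : gram AE G C e =
  block_mx (gram A g c p + N *m frame_gram h t p *m N^T) (N *m frame_gram h t p)
           (frame_gram h t p *m N^T) (frame_gram h t p).
Proof.
have hor_frame i a : h (K e (hor i)) (frame t a p) = (N *m frame_gram h t p) i a.
  rewrite connection_map_hor_frame (fiber_metric_suml hh) mxE.
  by apply: eq_bigr => b _; rewrite [frame_gram _ _ _ _ _]mxE.
apply/matrixP => i j; case: (split_ordP i) (split_ordP j) => [i'|a] -> [j'|b] ->.
- rewrite block_mxEul gram_hor [RHS]mxE; congr (_ + _).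
  rewrite [in LHS](connection_map_hor_frame j') (fiber_metric_sumr hh) mxE.
  by apply: eq_bigr => b _; rewrite hor_frame mulrC [N^T _ _]mxE.
- by rewrite block_mxEur gram_ver hor_frame.
- rewrite block_mxEdl gram_sym gram_ver hor_frame !mxE.
  apply: eq_bigr => b _.
  by rewrite [N^T _ _]mxE mulrC; congr (_ * _); rewrite !mxE (fiber_metric_sym hh).
- by rewrite block_mxEdr gram_ver -/(ver a) connection_map_ver mxE.
Qed.

Lemma det_gram_total :
  \det (gram AE G C e) = \det (gram A g c p) * \det (frame_gram h t p).
Proof. by rewrite gram_block det_congr_block. Qed.

(** In matrix form: the vertical vector [2 e] is the gradient of [r]. *)
Lemma gram_radial : gram AE G C e *m col_mx 0 (2 *: u^T) =
  \col_j pderiv j (r \o cinv C) Y.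
Proof.
apply/matrixP => j z; rewrite ord1 mxE [RHS]mxE.
rewrite big_split_ord /= big1 ?add0r; last first.
  by move=> i _; rewrite col_mxEu [X in _ * X]mxE mulr0.
have -> : pderiv j (r \o cinv C) Y = 2 * h (K e (coord_vec AE C j e)) (tinv t p u).
  case: (split_ordP j) => i ->; first exact: pderiv_sqnorm_horizontal.
  by rewrite (pderiv_sqnorm_vertical hM hE hh) // -/(ver i) connection_map_ver.
rewrite (tinv_sum hE u Tt tp) (fiber_metric_sumr hh) mulr_sumr.
by apply: eq_bigr => a _; rewrite gram_ver col_mxEd [X in _ * X]mxE [u^T _ _]mxE; ring.
Qed.

Lemma det_gram_total_gt0 : 0 < \det (gram AE G C e).
Proof.
rewrite det_gram_total mulr_gt0 //; first exact: (det_gram_metric_gt0 hM).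
exact: (det_frame_gram_gt0 hE).
Qed.

Lemma grad_radial (a b : R) i :
  \sum_j invmx (gram AE G C e) i j *
    pderiv j ((fun x => a * r x + b) \o cinv C) Y =
  a * (col_mx 0 (2 *: u^T) : 'cV[R]_(n + k)) i 0.
Proof.
have dr : differentiable (r \o cinv C) Y.
  apply: smooth_near_differentiable; rewrite /Y -(total_chart_map hE c u Tt tp).
  apply: (fiber_sqnorm_smooth hM hE hh); first exact: total_atlasE.
  by split.
have dF j : pderiv j ((fun x => a * r x + b) \o cinv C) Y =
            a * pderiv j (r \o cinv C) Y.
  rewrite (@pderivD _ _ (fun y => a * r (cinv C y)) (fun=> b)).
  - rewrite (@pderivM _ _ (fun=> a) (r \o cinv C)) //.
    by rewrite !pderiv_cst mulr0 !addr0.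
  - by apply: (@differentiableM _ _ (fun=> a) (r \o cinv C)).
  - exact: differentiable_cst.
have unit_gram : gram AE G C e \in unitmx.
  by rewrite unitmxE unitfE gt_eqF // det_gram_total_gt0.
rewrite -[col_mx _ _](mulKmx unit_gram) gram_radial mxE mulr_sumr.
by apply: eq_bigr => j _; rewrite dF [X in a * (_ * X)]mxE mulrCA.
Qed.

End AtPoint.

(** The flux is [vol (x) * (0, 2 a u)]; since [vol] does not depend on [u],
    each of the [k] vertical directions contributes [2 a vol] to the
    divergence. *)
Lemma laplacian_radial (a b : R) C e : AE C -> cdom C e ->
  laplacian_in AE G C (fun x => a * r x + b) e = a * 2 *+ k.
Proof.
move=> [c [t [Ac Tt ->]]] [] cp tp; rewrite (in_fiber_tinv hE Tt tp).
set p := bundle_proj e in cp tp *; set u := tmap t (projT2 e).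
set C0 := total_chart c t.
rewrite /laplacian_in (total_chart_map hE) //; set Y := row_mx _ u.
pose vol0 (x : 'rV[R]_n) :=
  Num.sqrt (\det (gram A g c (cinv c x)) * \det (frame_gram h t (cinv c x))).
have volE : Num.sqrt (\det (gram AE G C0 (cinv C0 Y))) = vol0 (cmap c p).
  by rewrite (total_chart_inv hM) // det_gram_total // /vol0 (atlas_mapK hM).
have vol_neq0 : vol0 (cmap c p) != 0.
  by rewrite -volE (total_chart_inv hM) // gt_eqF // sqrtr_gt0 det_gram_total_gt0.
have flux_near i : \forall y \near Y,
    Num.sqrt (\det (gram AE G C0 (cinv C0 y))) *
      (\sum_j invmx (gram AE G C0 (cinv C0 y)) i j *
         pderiv j ((fun x => a * r x + b) \o cinv C0) y) =
    vol0 (lsubmx y) * (a * (col_mx 0 (2 *: (rsubmx y)^T) : 'cV[R]_(n + k)) i 0).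
  have := total_chart_near hM hE u Ac Tt cp tp.
  apply: filterS => y /= [cq tq qE]; set q := cinv c (lsubmx y) in cq tq qE *.
  have yE : y = row_mx (cmap c q) (rsubmx y) by rewrite qE hsubmxK.
  (* only the point of differentiation is put in the form [(cmap c q, u)] *)
  rewrite -[in_fiber _]/(in_fiber (tinv t q (rsubmx y))) {3}yE.
  by rewrite grad_radial // det_gram_total.
under eq_bigr => i _ do rewrite (pderiv_near_eq i (flux_near i)).
rewrite volE big_split_ord /= [X in _ * (X + _)]big1 ?add0r => [|i _]; last first.
  rewrite (_ : (fun y => _) = fun=> 0) ?pderiv_cst //; apply/funext => y.
  by rewrite col_mxEu [X in a * X]mxE !mulr0.
have dvol l : pderiv (rshift n l) (fun y => vol0 (lsubmx y) *
    (a * (col_mx 0 (2 *: (rsubmx y)^T) : 'cV[R]_(n + k)) (rshift n l) 0)) Y =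
    vol0 (cmap c p) * (a * 2).
  rewrite (_ : (fun y => _) =
    fun y => vol0 (lsubmx y) * (a * 2 * y 0 (rshift n l))); last first.
    by apply/funext => y; rewrite col_mxEd !mxE mulrA.
  rewrite (@pderiv_constM _ _ (vol0 \o lsubmx)).
  - rewrite (@pderivM _ _ (fun=> a * 2)); first last.
    + exact: differentiable_coord.
    + exact: differentiable_cst.
    by rewrite pderiv_cst pderiv_coord eqxx mulr0 addr0 mulr1 /= row_mxKl.
  - move=> s /=; congr vol0; apply/rowP => i.
    by rewrite !mxE eq_lrshift mulr0 addr0.
  - apply: (@differentiableM _ _ (fun=> a * 2)); first exact: differentiable_cst.
    exact: differentiable_coord.
under eq_bigr => l _ do rewrite dvol.
by rewrite sumr_const card_ord -[RHS](mulKf vol_neq0) !mulrnAr.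
Qed.
End Laplacian.

(** * Biharmonicity *)

Lemma laplacian_cst (R : realType) (n : nat) (X : Type) (A : set (chart R n X))
    (G : X -> functional R X -> functional R X -> R) c (a : R) p :
  laplacian_in A G c (fun=> a) p = 0.
Proof.
rewrite /laplacian_in big1 ?mulr0 // => i _.
rewrite (_ : (fun x => _) = fun=> 0) ?pderiv_cst //; apply/funext => x.
by rewrite big1 ?mulr0 // => j _; rewrite pderiv_cst mulr0.
Qed.

Theorem corollary3p6 (R : realType) (n k : nat) (M : topologicalType)
    (A : set (chart R n M)) (hM : smooth_manifold A)
    (g : M -> functional R M -> functional R M -> R)
    (hg : riemannian_metric A g)
    (E : M -> lmodType R) (T : set (trivialization k E))
    (hk : (1 <= k)%N) (hE : vector_bundle A T)
    (h : forall p, E p -> E p -> R) (hh : fiber_metric A T h)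
    (D : forall p, functional R M -> (forall q, E q) -> E p)
    (hD : connection A T D) (hDh : compatible A T D h)
    (K : forall e : total_space E,
       functional R (total_space E) -> E (bundle_proj e))
    (hK : connection_map A T D K)
    (alpha : R -> R) (P : {poly R}) (hP : size P = 2%N)
    (halpha : forall t, 0 <= t -> alpha t = P.[t]) :
  biharmonic (total_atlas A T)
    (spherically_symmetric_metric A g h K (fun=> 0) (fun=> 0))
    (fun e => alpha (fiber_sqnorm h e)).

Proof.
pose r := fiber_sqnorm h.
have -> : (fun e : total_space E => alpha (r e)) = fun e => P`_1 * r e + P`_0.
  apply/funext => e; rewrite halpha; last exact: (fiber_sqnorm_ge0 hh).
  by rewrite horner_coef hP !big_ord_recl big_ord0 /= expr0 expr1 mulr1 addr0 addrC.
have smooth_cst (a : R) : smooth_fun (total_atlas A T) (fun=> a).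
  by move=> e C _ _; exact: smooth_near_cst.
split.
  move=> e; apply: smooth_at_linear => //.
    exact: (fiber_sqnorm_smooth hM hE hh).
  exact: smooth_cst.
exists (fun=> P`_1 * 2 *+ k); split => //.
- by move=> C e AC Ce; rewrite (laplacian_radial hM hE hg hh hDh hK).
- by move=> C e _ _; rewrite laplacian_cst.
Qed.
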